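(* Let $t,k\in\mathbb{N}_0$ and $\gamma\in\mathbb{R}_{>0}$. Suppose $\tilde R_{k|t}$ is non-singular, $\tilde B_{k|t}\tilde R_{k|t}^{-1}\tilde B_{k|t}'\in\mathbb{S}_{++}^n$, and $\tilde Q_{k|t}\in\mathbb{S}_{++}^n$. Then, for any $X,P\in\mathbb{S}_{++}^n$, $$\delta(\tilde{\mathcal{R}}_{\gamma,k|t}(X),\tilde{\mathcal{R}}_{\gamma,k|t}(P))\le\tilde\rho_{k|t}\cdot\delta(X,P)$$ with $\tilde\rho_{k|t}:=\tilde\zeta_{k|t}/(\tilde\zeta_{k|t}+\tilde\epsilon_{k|t})<1$, where $$\tilde\zeta_{k|t}:=1\big/\lambda_{\min}\big(\tilde Q_{k|t}+\tilde Q_{k|t}\tilde A_{k|t}^{-1}\tilde B_{k|t}\tilde R_{k|t}^{-1}\tilde B_{k|t}'(\tilde A_{k|t}')^{-1}\tilde Q_{k|t}\big),$$ $$\tilde\epsilon_{k|t}:=1\big/\lambda_{\max}\big(\tilde Q_{k|t}+\tilde A_{k|t}'(\tilde B_{k|t}\tilde R_{k|t}^{-1}\tilde B_{k|t}')^{-1}\tilde A_{k|t}\big).$$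
   Context: Notation. $\mathbb{N}_0=\{0\}\cup\mathbb{N}$. $X'$ is the transpose of $X$. $\mathbb{S}^n$, $\mathbb{S}_+^n$, $\mathbb{S}_{++}^n$ are the real symmetric, symmetric positive semidefinite, and symmetric positive definite $n\times n$ matrices. $Y\preceq Z$ means $Z-Y\in\mathbb{S}_+^n$. $Z^{1/2}$ is the positive semidefinite square root of $Z\in\mathbb{S}_+^n$. $0_{p,q}$ is the $p\times q$ zero matrix. $\mathrm{diag}(\cdot)$ is block diagonal. Model data. $A_t\in\mathbb{R}^{n\times n}$, $B_t\in\mathbb{R}^{n\times m}$, $Q_t\in\mathbb{S}_+^n$, $R_t\in\mathbb{S}_{++}^m$, $t\in\mathbb{N}_0$ (of the system $x_{t+1}=A_tx_t+B_tu_t+w_t$ with output $z_t=(Q_t^{1/2}x_t,R_t^{1/2}u_t)$). Standing assumptions. (i) $A_t,B_t,Q_t,R_t$ and the inverses $A_t^{-1},R_t^{-1}$ are uniformly bounded over $t\in\mathbb{N}_0$ (in particular $A_t$ is non-singular). (ii) With $\Phi_{t,t}:=I_n$ and $\Phi_{s,t}:=A_{s-1}\cdots A_t$ for $s>t$, there exist $d\in\mathbb{N}$ and $c>0$ such that for all $t\in\mathbb{N}_0$: $\sum_{s=t}^{t+d-1}\Phi_{s,t}'Q_s\Phi_{s,t}\succeq cI_n$ and $\sum_{s=t}^{t+d-1}\Phi_{t+d,s+1}B_sB_s'\Phi_{t+d,s+1}'\succeq cI_n$. Such a $d$ is fixed throughout. Lifted data. For $t,k\in\mathbb{N}_0$ let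 $\Lambda_{k|t}:=I_{n(d+1)}-\begin{bmatrix}0_{n,nd}&0_{n,n}\\ \mathrm{diag}(A_{t+dk},\dots,A_{t+d(k+1)-1})&0_{nd,n}\end{bmatrix}$, $\Xi_{k|t}:=\begin{bmatrix}0_{n,md}\\ \mathrm{diag}(B_{t+dk},\dots,B_{t+d(k+1)-1})\end{bmatrix}$, $\Gamma_{k|t}:=\begin{bmatrix}\mathrm{diag}(Q_{t+dk}^{1/2},\dots,Q_{t+d(k+1)-1}^{1/2})&0_{nd,n}\end{bmatrix}$, $R_{k|t}:=\mathrm{diag}(R_{t+dk},\dots,R_{t+d(k+1)-1})$, and $A_{k|t}:=\begin{bmatrix}0_{n,nd}&I_n\end{bmatrix}\Lambda_{k|t}^{-1}\begin{bmatrix}I_n\\ 0_{nd,n}\end{bmatrix}$, $B_{k|t}:=\begin{bmatrix}0_{n,nd}&I_n\end{bmatrix}\Lambda_{k|t}^{-1}\Xi_{k|t}$, $F_{k|t}:=\begin{bmatrix}0_{n,nd}&I_n\end{bmatrix}\Lambda_{k|t}^{-1}\begin{bmatrix}0_{n,nd}\\ I_{nd}\end{bmatrix}$, $C_{k|t}:=\Gamma_{k|t}\Lambda_{k|t}^{-1}\begin{bmatrix}I_n\\ 0_{nd,n}\end{bmatrix}$, $D_{k|t}:=\Gamma_{k|t}\Lambda_{k|t}^{-1}\Xi_{k|t}$, $E_{k|t}:=\Gamma_{k|t}\Lambda_{k|t}^{-1}\begin{bmatrix}0_{n,nd}\\ I_{nd}\end{bmatrix}$. Transformed lifted data (depending on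 $\gamma$). $\tilde B_{k|t}:=\begin{bmatrix}B_{k|t}&F_{k|t}\end{bmatrix}$, $\tilde R_{k|t}:=\begin{bmatrix}R_{k|t}+D_{k|t}'D_{k|t}&D_{k|t}'E_{k|t}\\ E_{k|t}'D_{k|t}&E_{k|t}'E_{k|t}-\gamma^2I_{nd}\end{bmatrix}$, and, when $\tilde R_{k|t}$ is non-singular, $\tilde Q_{k|t}:=C_{k|t}'C_{k|t}-C_{k|t}'\begin{bmatrix}D_{k|t}&E_{k|t}\end{bmatrix}\tilde R_{k|t}^{-1}\begin{bmatrix}D_{k|t}'\\ E_{k|t}'\end{bmatrix}C_{k|t}$ and $\tilde A_{k|t}:=A_{k|t}-\begin{bmatrix}B_{k|t}&F_{k|t}\end{bmatrix}\tilde R_{k|t}^{-1}\begin{bmatrix}D_{k|t}'\\ E_{k|t}'\end{bmatrix}C_{k|t}$ (non-singular whenever $\tilde R_{k|t}$ is). Lifted Riccati operator. $\tilde{\mathcal{R}}_{\gamma,k|t}(X):=\tilde Q_{k|t}+\tilde A_{k|t}'\big(X-X\tilde B_{k|t}(\tilde R_{k|t}+\tilde B_{k|t}'X\tilde B_{k|t})^{-1}\tilde B_{k|t}'X\big)\tilde A_{k|t}$. Riemannian distance. For $X,P\in\mathbb{S}_{++}^n$, $\delta(X,P):=\sqrt{\sum_{i=1}^n(\log\lambda_i)^2}$, where $\lambda_1,\dots,\lambda_n>0$ are the eigenvalues of $XP^{-1}$ with multiplicity. *)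

(* Defs.v *)
From HB Require Import structures.
From mathcomp Require Import all_boot all_order all_algebra.
From mathcomp Require Import all_classical all_reals all_analysis.
Set Implicit Arguments.
Unset Strict Implicit.
Unset Printing Implicit Defensive.
Import Order.TTheory GRing.Theory Num.Theory.
Import numFieldNormedType.Exports.
Local Open Scope classical_set_scope.
Local Open Scope ring_scope.

Definition psdmx (R : realType) (n : nat) (Z : 'M[R]_n) : Prop :=
  Z^T = Z /\ forall x : 'cV[R]_n, 0 <= (x^T *m Z *m x) 0 0.

Definition pdmx (R : realType) (n : nat) (Z : 'M[R]_n) : Prop :=
  Z^T = Z /\ forall x : 'cV[R]_n, x != 0 -> 0 < (x^T *m Z *m x) 0 0.

Definition loewner_le (R : realType) (n : nat) (Y Z : 'M[R]_n) : Prop :=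
  psdmx (Z - Y).

(* Meaningful for Z positive semidefinite, where S exists and is unique. *)
Definition sqrtmx (R : realType) (n : nat) (Z : 'M[R]_n) : 'M[R]_n :=
  xget 0 [set S : 'M[R]_n | psdmx S /\ S *m S = Z].

(* The norm is the entrywise maximum; all norms are equivalent here. *)
Definition unif_bounded (R : realType) (p q : nat) (M : nat -> 'M[R]_(p, q)) :
    Prop :=
  exists b : R, forall t, `|M t| <= b.

(* The eigenvalues with (algebraic) multiplicity, in an unspecified order;
   meaningful when the characteristic polynomial of M splits over R. *)
Definition eigenvalues (R : realType) (n : nat) (M : 'M[R]_n) : seq R :=
  xget [::] [set s : seq R | char_poly M = \prod_(a <- s) ('X - a%:P)].

Definition riem_dist (R : realType) (n : nat) (X P : 'M[R]_n) : R :=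
  Num.sqrt (\sum_(a <- eigenvalues (X *m invmx P)) ln a ^+ 2).

(* The set is finite, and nonempty for symmetric M of positive size, so that
   inf and sup are attained. *)
Definition lambda_min (R : realType) (n : nat) (M : 'M[R]_n) : R :=
  inf [set a : R | eigenvalue M a].

Definition lambda_max (R : realType) (n : nat) (M : 'M[R]_n) : R :=
  sup [set a : R | eigenvalue M a].

Record ltv_data (R : realType) (n m : nat) := LTVData {
  dA : nat -> 'M[R]_n;
  dB : nat -> 'M[R]_(n, m);
  dQ : nat -> 'M[R]_n;
  dR : nat -> 'M[R]_m }.

(* A_{s-1} ... A_t for t <= s. *)
Definition Phi (R : realType) (n : nat) (A : nat -> 'M[R]_n) (s t : nat) :
    'M[R]_n :=
  iteri (s - t) (fun j M => A (t + j)%N *m M) 1%:M.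

Definition regular_bounded (R : realType) (n m : nat) (S : ltv_data R n m) :
    Prop :=
  (forall t, psdmx (dQ S t)) /\ (forall t, pdmx (dR S t)) /\
  (forall t, dA S t \in unitmx) /\
  unif_bounded (dA S) /\ unif_bounded (dB S) /\
  unif_bounded (dQ S) /\ unif_bounded (dR S) /\
  unif_bounded (fun t => invmx (dA S t)) /\
  unif_bounded (fun t => invmx (dR S t)).

Definition unif_observable (R : realType) (n m : nat) (S : ltv_data R n m)
    (d : nat) (c : R) : Prop :=
  forall t : nat, loewner_le c%:M
    (\sum_(t <= s < t + d) (Phi (dA S) s t)^T *m dQ S s *m Phi (dA S) s t).

Definition unif_controllable (R : realType) (n m : nat) (S : ltv_data R n m)
    (d : nat) (c : R) : Prop :=
  forall t : nat, loewner_le c%:M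
    (\sum_(t <= s < t + d)
       Phi (dA S) (t + d) s.+1 *m dB S s *m (dB S s)^T
         *m (Phi (dA S) (t + d) s.+1)^T).

(* The product d * p, in the form used by \mxblock. *)
Notation rep d p := (\sum_(i < d) p)%N.

Definition blkdiag (R : realType) (d p q : nat) (M : nat -> 'M[R]_(p, q)) :
    'M[R]_(rep d p, rep d q) :=
  \mxblock_(i < d, j < d) (if i == j then M i else 0).

(* The lifted state is partitioned as n + nd along the rows of Lambda and as
   nd + n along its columns; colcast identifies the two index types, keeping
   the position of every column. *)
Definition colcast (R : realType) (p a b : nat) (M : 'M[R]_(p, a + b)) :
    'M[R]_(p, b + a) :=
  castmx (erefl p, addnC a b) M.

Section Lifting.
Context (R : realType) (n m : nat) (S : ltv_data R n m) (d t k : nat).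

Definition liftLambda : 'M[R]_(n + rep d n) :=
  1%:M - colcast (block_mx
    (0 : 'M[R]_(n, rep d n))                      (0 : 'M[R]_n)
    (blkdiag d (fun i => dA S (t + d * k + i)%N)) (0 : 'M[R]_(rep d n, n))).

Definition liftXi : 'M[R]_(n + rep d n, rep d m) :=
  col_mx (0 : 'M[R]_(n, rep d m))
         (blkdiag d (fun i => dB S (t + d * k + i)%N)).

Definition liftGamma : 'M[R]_(rep d n, n + rep d n) :=
  colcast (row_mx (blkdiag d (fun i => sqrtmx (dQ S (t + d * k + i)%N)))
                  (0 : 'M[R]_(rep d n, n))).

Definition liftR : 'M[R]_(rep d m) :=
  blkdiag d (fun i => dR S (t + d * k + i)%N).

Definition sel_last : 'M[R]_(n, n + rep d n) :=
  colcast (row_mx (0 : 'M[R]_(n, rep d n)) 1%:M).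

Definition inj_first : 'M[R]_(n + rep d n, n) :=
  col_mx 1%:M (0 : 'M[R]_(rep d n, n)).

Definition inj_rest : 'M[R]_(n + rep d n, rep d n) :=
  col_mx (0 : 'M[R]_(n, rep d n)) 1%:M.

Definition liftA : 'M[R]_n := sel_last *m invmx liftLambda *m inj_first.
Definition liftB : 'M[R]_(n, rep d m) := sel_last *m invmx liftLambda *m liftXi.
Definition liftF : 'M[R]_(n, rep d n) :=
  sel_last *m invmx liftLambda *m inj_rest.
Definition liftC : 'M[R]_(rep d n, n) :=
  liftGamma *m invmx liftLambda *m inj_first.
Definition liftD : 'M[R]_(rep d n, rep d m) :=
  liftGamma *m invmx liftLambda *m liftXi.
Definition liftE : 'M[R]_(rep d n) := liftGamma *m invmx liftLambda *m inj_rest.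

Context (gamma : R).

Definition tildeB : 'M[R]_(n, rep d m + rep d n) := row_mx liftB liftF.

Definition tildeR : 'M[R]_(rep d m + rep d n) :=
  block_mx (liftR + liftD^T *m liftD) (liftD^T *m liftE)
           (liftE^T *m liftD)         (liftE^T *m liftE - (gamma ^+ 2)%:M).

Definition tildeQ : 'M[R]_n :=
  liftC^T *m liftC
  - liftC^T *m row_mx liftD liftE *m invmx tildeR *m col_mx liftD^T liftE^T
      *m liftC.

Definition tildeA : 'M[R]_n :=
  liftA - row_mx liftB liftF *m invmx tildeR *m col_mx liftD^T liftE^T *m liftC.

Definition lifted_riccati (X : 'M[R]_n) : 'M[R]_n :=
  tildeQ + tildeA^T
    *m (X - X *m tildeB *m invmx (tildeR + tildeB^T *m X *m tildeB)
              *m tildeB^T *m X)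
    *m tildeA.

Definition tildeBRB : 'M[R]_n := tildeB *m invmx tildeR *m tildeB^T.

Definition tilde_zeta : R :=
  1 / lambda_min (tildeQ + tildeQ *m invmx tildeA *m tildeBRB
                             *m invmx (tildeA^T) *m tildeQ).

Definition tilde_epsilon : R :=
  1 / lambda_max (tildeQ + tildeA^T *m invmx tildeBRB *m tildeA).

Definition tilde_rho : R := tilde_zeta / (tilde_zeta + tilde_epsilon).

End Lifting.

(* Main.v *)
Require Import Defs.
From mathcomp Require Import all_boot all_order all_algebra all_fingroup.
From mathcomp Require Import all_classical all_reals all_analysis.
From mathcomp Require Import complex ring lra.
Set Implicit Arguments.
Unset Strict Implicit.
Unset Printing Implicit Defensive.
Import Order.TTheory GRing.Theory Num.Theory.
Local Open Scope ring_scope.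

(* Write Q, A, B, R for the transformed data, W = B R^-1 B' and
   M = A' W^-1 A.  By Woodbury the Riccati operator is
   ric(X) = Q + A' (X^-1 + W)^-1 A, and
     ric(X)^-1 = (Q + M)^-1 + (N + T' X T)^-1,
   where N = Q + Q M^-1 Q and T = A (M^-1 Q + 1).  The distance is invariant
   under inversion and congruence, and the translation Y |-> G + Y contracts it
   by the factor a / (a + b) on {Y <= a I} when G >= b I >= 0.  This is applied
   to N (with b = 0), and then to G = (Q + M)^-1 >= epsilon I with
   (N + T' X T)^-1 <= N^-1 <= zeta I.  The contraction of translations holds
   eigenvalue by eigenvalue, by Courant-Fischer, from a scalar inequality on
   the Rayleigh quotients.  The argument needs A to be invertible, which is
   proved by running the Hamiltonian recursion of the lifted system
   backwards. *)

(** * Positive definite matrices and simultaneous diagonalization *)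

(** Row vectors fit the row-space conventions of [kermx] and [row_base]; [pdmxP] translates from the
    column vectors of [pdmx]. *)
Definition qf (R : realType) (n : nat) (A : 'M[R]_n) (x : 'rV[R]_n) : R :=
  (x *m A *m x^T) 0 0.

Lemma trmx_neq0 (R : realType) (m n : nat) (A : 'M[R]_(m, n)) :
  (A^T != 0) = (A != 0).
Proof. by rewrite -[0 in LHS]trmx0 (inj_eq (@trmx_inj _ _ _)). Qed.

Lemma pdmxP (R : realType) (n : nat) (A : 'M[R]_n) :
  pdmx A <-> A^T = A /\ forall x, x != 0 -> 0 < qf A x.
Proof.
split=> -[sA pA]; split=> // x x0.
  by have := pA x^T; rewrite trmxK trmx_neq0; apply.
by have := pA x^T; rewrite /qf trmxK trmx_neq0; apply.
Qed.

Lemma qf_gt0 (R : realType) (n : nat) (A : 'M[R]_n) (x : 'rV[R]_n) :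
  pdmx A -> x != 0 -> 0 < qf A x.
Proof. by move=> /pdmxP[_]; apply. Qed.

Lemma qf0 (R : realType) (n : nat) (A : 'M[R]_n) : qf A 0 = 0.
Proof. by rewrite /qf !mul0mx mxE. Qed.

Lemma qf_ge0 (R : realType) (n : nat) (A : 'M[R]_n) (x : 'rV[R]_n) :
  pdmx A -> 0 <= qf A x.
Proof.
move=> pA; have [->|x0] := eqVneq x 0; first by rewrite qf0.
exact/ltW/qf_gt0.
Qed.

Lemma qfD (R : realType) (n : nat) (A B : 'M[R]_n) (x : 'rV[R]_n) :
  qf (A + B) x = qf A x + qf B x.
Proof. by rewrite /qf mulmxDr mulmxDl mxE. Qed.

Lemma qf_congr (R : realType) (m n : nat) (T : 'M[R]_(m, n)) (A : 'M[R]_n)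
  (x : 'rV[R]_m) : qf (T *m A *m T^T) x = qf A (x *m T).
Proof. by rewrite /qf trmx_mul !mulmxA. Qed.

Lemma pdmxD (R : realType) (n : nat) (A B : 'M[R]_n) :
  pdmx A -> pdmx B -> pdmx (A + B).
Proof.
move=> pA pB; apply/pdmxP; split; first by rewrite linearD /= pA.1 pB.1.
by move=> x x0; rewrite qfD addr_gt0 ?qf_gt0.
Qed.

Lemma pdmx_congr_free (R : realType) (m n : nat) (T : 'M[R]_(m, n))
  (A : 'M[R]_n) : row_free T -> pdmx A -> pdmx (T *m A *m T^T).
Proof.
move=> fT pA; apply/pdmxP; split.
  by rewrite !trmx_mul trmxK pA.1 mulmxA.
move=> x x0; rewrite qf_congr qf_gt0 //.
by apply: contra x0 => /eqP xT; rewrite -(inj_eq (row_free_inj fT)) xT mul0mx.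
Qed.

Lemma pdmx_congr (R : realType) (n : nat) (T A : 'M[R]_n) :
  T \in unitmx -> pdmx A -> pdmx (T^T *m A *m T).
Proof.
move=> uT pA; rewrite -[X in _ *m X]trmxK.
by apply: pdmx_congr_free; rewrite // row_free_unit unitmx_tr.
Qed.

Lemma pdmx_unit (R : realType) (n : nat) (A : 'M[R]_n) :
  pdmx A -> A \in unitmx.
Proof.
move=> pA; rewrite -row_free_unit -kermx_eq0; apply/eqP/row_matrixP => i.
rewrite row0; apply/eqP/negPn/negP => /(qf_gt0 pA).
by rewrite /qf -row_mul mulmx_ker row0 mul0mx mxE ltxx.
Qed.

Lemma pdmx_inv (R : realType) (n : nat) (A : 'M[R]_n) :
  pdmx A -> pdmx (invmx A).
Proof.
move=> pA; have uA := pdmx_unit pA.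
have -> : invmx A = (invmx A)^T *m A *m invmx A.
  by rewrite trmx_inv pA.1 mulVmx // mul1mx.
by apply: pdmx_congr; rewrite ?unitmx_inv.
Qed.

(* A complex eigenvalue [a + i b] of the pencil, with eigenvector [u + i v],
   is real: comparing [u Y v^T] with [v Y u^T] gives
   [b (u Z u^T + v Z v^T) = 0]. *)
Lemma pencil_eigenvector (R : realType) (n : nat) (Y Z : 'M[R]_n.+1) :
  Y^T = Y -> pdmx Z ->
  exists a : R, exists2 x : 'rV[R]_n.+1, x != 0 & x *m Y = a *: (x *m Z).
Proof.
move=> sY pZ; have uZ := pdmx_unit pZ; have sZ := pZ.1.
pose M := Y *m invmx Z.
pose Mc := map_mx (real_complex R) M.
have /closed_rootP[z] : size (char_poly Mc) != 1%N by rewrite size_char_poly.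
rewrite -eigenvalue_root_char => /eigenvalueP[w wM w0].
case: z wM => a b wM.
pose u := map_mx (@complex.Re R) w; pose v := map_mx (@complex.Im R) w.
have eRe : u *m M = a *: u - b *: v.
  apply/rowP => j; have := congr1 (fun t : 'rV[_]_n.+1 => complex.Re (t 0 j)) wM.
  rewrite !mxE (raddf_sum (@complex.Re R)) /=.
  rewrite (eq_bigr (fun k => u 0 k * M k j)).
    by move=> ->; case: (w 0 j).
  by move=> k _; rewrite !mxE; case: (w 0 k) => x y /=; rewrite mulr0 subr0.
have eIm : v *m M = a *: v + b *: u.
  apply/rowP => j; have := congr1 (fun t : 'rV[_]_n.+1 => complex.Im (t 0 j)) wM.
  rewrite !mxE (raddf_sum (@complex.Im R)) /=.
  rewrite (eq_bigr (fun k => v 0 k * M k j)).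
    by move=> ->; case: (w 0 j).
  by move=> k _; rewrite !mxE; case: (w 0 k) => x y /=; rewrite mulr0 add0r.
have MZ : M *m Z = Y by rewrite /M mulmxKV.
have uY : u *m Y = a *: (u *m Z) - b *: (v *m Z).
  by rewrite -MZ mulmxA eRe mulmxBl -!scalemxAl.
have vY : v *m Y = a *: (v *m Z) + b *: (u *m Z).
  by rewrite -MZ mulmxA eIm mulmxDl -!scalemxAl.
have uv0 : (u != 0) || (v != 0).
  rewrite -negb_and; apply: contra w0 => /andP[/eqP u0 /eqP v0].
  apply/eqP/rowP => j; move: (congr1 (fun t : 'rV[_]_n.+1 => t 0 j) u0).
  move: (congr1 (fun t : 'rV[_]_n.+1 => t 0 j) v0); rewrite !mxE.
  by case: (w 0 j) => x y /= -> ->.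
have swap (C : 'M[R]_n.+1) : C^T = C -> (v *m C *m u^T) 0 0 = (u *m C *m v^T) 0 0.
  move=> sC; have -> : v *m C *m u^T = (u *m C *m v^T)^T.
    by rewrite !trmx_mul trmxK sC mulmxA.
  by rewrite mxE.
have : b * (qf Z u + qf Z v) = 0.
  have := swap Y sY; rewrite uY vY mulmxDl mulmxBl -!scalemxAl.
  rewrite /qf; have := swap Z sZ.
  move: (v *m Z *m u^T) (u *m Z *m v^T) (u *m Z *m u^T) (v *m Z *m v^T).
  by move=> e1 e2 e3 e4; rewrite !mxE => ->; lra.
have : 0 < qf Z u + qf Z v.
  by case/orP: uv0 => h; [rewrite ltr_pwDl|rewrite ltr_pwDr];
    rewrite ?qf_gt0 ?qf_ge0.
move=> /lt0r_neq0 /negbTE q0 /eqP; rewrite mulf_eq0 q0 orbF => /eqP b0.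
exists a; case/orP: uv0 => h; [exists u|exists v] => //.
  by rewrite uY b0 scale0r subr0.
by rewrite vY b0 scale0r addr0.
Qed.

Lemma kermx_basis (R : realType) (n : nat) (c : 'cV[R]_n.+1) :
  c != 0 -> exists2 U : 'M[R]_(n, n.+1), row_free U & U *m c = 0.
Proof.
move=> c0; have rk : \rank (kermx c) = n.
  by rewrite mxrank_ker -mxrank_tr rank_rV trmx_neq0 c0 subSS subn0.
(* The row count of [row_base] is a rank expression; naming it [r] lets the rank equation be
   substituted in the type. *)
suff H r : \rank (kermx c) = r ->
    exists2 U : 'M[R]_(r, n.+1), row_free U & U *m c = 0 by exact: H.
move=> <-; exists (row_base (kermx c)); first exact: row_base_free.
by apply/sub_kermxP; rewrite eq_row_base.
Qed.

(** The rows of [V] are generalized eigenvectors, [v Y = l v Z], orthonormal for [Z]; for invertible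
    [Z] the entries of [l] are the eigenvalues of [Y Z^-1]. *)
Definition codiag (R : realType) (n : nat) (Y Z V : 'M[R]_n) (l : 'rV[R]_n) :=
  V *m Z *m V^T = 1%:M /\ V *m Y *m V^T = diag_mx l.

(** Deflation: since [x Y = a x Z], the [Z]-orthogonal complement of the eigenvector [x] is also
    [Y]-orthogonal to [x], and the induction hypothesis applies to both forms restricted to it. *)
Lemma codiag_exists (R : realType) (n : nat) (Y Z : 'M[R]_n) :
  Y^T = Y -> pdmx Z -> exists V l, codiag Y Z V l.
Proof.
elim: n Y Z => [|n IH] Y Z sY pZ.
  by exists 0, 0; split; apply/matrixP => -[].
have [a [x x0 xY]] := pencil_eigenvector sY pZ.
have xZ0 : x *m Z != 0.
  by apply: contra x0 => /eqP xZ; rewrite -(mulmxK (pdmx_unit pZ) x) xZ mul0mx.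
(* The rows of [U] form a basis of the [Z]-orthogonal complement of [x]. *)
have [U fU Ux] : exists2 U : 'M[R]_(n, n.+1), row_free U & U *m (x *m Z)^T = 0.
  by apply: kermx_basis; rewrite trmx_neq0.
have xU : x *m Z *m U^T = 0 by apply: trmx_inj; rewrite trmx_mul trmxK Ux trmx0.
have q0 := qf_gt0 pZ x0.
have [||V [l [VZ VY]]] := IH (U *m Y *m U^T) (U *m Z *m U^T).
- by rewrite !trmx_mul trmxK sY mulmxA.
- exact: pdmx_congr_free.
pose s := (Num.sqrt (qf Z x))^-1.
have s2 : s * s * qf Z x = 1.
  rewrite -invfM -expr2 sqr_sqrtr ?ltW // mulVf //; exact: lt0r_neq0.
have xx : s *: x *m Z *m (s *: x)^T = 1%:M.
  rewrite linearZ /= -!scalemxAl -scalemxAr scalerA [X in _ *: X]mx11_scalar.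
  by rewrite scale_scalar_mx -/(qf Z x) s2.
have xV : s *: x *m Z *m (V *m U)^T = 0.
  by rewrite trmx_mul mulmxA -!scalemxAl xU mul0mx scaler0.
have Vx : V *m U *m Z *m (s *: x)^T = 0.
  apply: trmx_inj; rewrite [in LHS]trmx_mul trmxK [in LHS]trmx_mul pZ.1.
  by rewrite mulmxA xV trmx0.
have sxY : s *: x *m Y = a *: (s *: x *m Z).
  by rewrite -scalemxAl xY -scalemxAl !scalerA mulrC.
have Vx' : V *m U *m Y *m (s *: x)^T = 0.
  apply: trmx_inj; rewrite [in LHS]trmx_mul trmxK [in LHS]trmx_mul sY.
  by rewrite mulmxA sxY -(scalemxAl a) xV scaler0 trmx0.
pose W : 'M[R]_(1 + n, n.+1) := col_mx (s *: x) (V *m U).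
have WE C : W *m C *m W^T = block_mx
    (s *: x *m C *m (s *: x)^T) (s *: x *m C *m (V *m U)^T)
    (V *m U *m C *m (s *: x)^T) (V *m (U *m C *m U^T) *m V^T).
  rewrite /W mul_col_mx tr_col_mx mul_col_row.
  by rewrite [(V *m U)^T in X in block_mx _ _ _ X]trmx_mul !mulmxA.
exists W, (row_mx a%:M l : 'rV[R]_(1 + n)); split.
  apply: etrans (WE Z) _.
  by rewrite xx xV Vx VZ -scalar_mx_block.
apply: etrans (WE Y) _.
rewrite Vx' VY sxY -!(scalemxAl a) xx xV scaler0 scale_scalar_mx mulr1.
apply: esym; apply: etrans (diag_mx_row _ _) _; congr block_mx.
by apply/matrixP => i j; rewrite !mxE !ord1.
Qed.

Lemma codiag_sorted (R : realType) (n : nat) (Y Z : 'M[R]_n) :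
  Y^T = Y -> pdmx Z -> exists V, exists2 l, codiag Y Z V l &
    forall i j : 'I_n, (i <= j)%N -> l 0 j <= l 0 i.
Proof.
move=> sY pZ; have [V [l [VZ VY]]] := codiag_exists sY pZ.
pose s := [tuple l 0 i | i < n].
have [p sp] : exists p : 'S_n, sort_tuple >=%R s = [tuple tnth s (p i) | i < n].
  have /tuple_permP[p sp] : perm_eq (sort_tuple >=%R s) s.
    by rewrite /= perm_sort.
  by exists p; apply: val_inj; exact: sp.
have lp i : nth 0 (sort >=%R s) i = nth 0 [tuple tnth s (p i) | i < n] i.
  by rewrite -sp.
exists (row_perm p V), (col_perm p l).
  have E C : row_perm p V *m C *m (row_perm p V)^T =
      perm_mx p *m (V *m C *m V^T) *m perm_mx p^-1.
    by rewrite row_permE trmx_mul tr_perm_mx !mulmxA.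
  split; rewrite E ?VZ ?VY; first by rewrite mulmx1 -perm_mxM mulgV perm_mx1.
  rewrite -row_permE -col_permE; apply/matrixP => i j.
  by rewrite !mxE (inj_eq perm_inj).
move=> i j ij; rewrite !mxE.
have nthE (k : 'I_n) : l 0 (p k) = nth 0 (sort >=%R s) k.
  by rewrite lp -tnth_nth !tnth_mktuple.
rewrite !nthE; apply: (sorted_leq_nth (leT := >=%R)) => //.
- by move=> x y z /= h1 h2; apply: le_trans h2 h1.
- by move=> x /=.
- by apply: sort_sorted => x y /=; apply: le_total.
- by rewrite inE size_sort size_tuple.
- by rewrite inE size_sort size_tuple.
Qed.

Section Codiag.
Context (R : realType) (n : nat).
Implicit Types (X Y Z V T : 'M[R]_n) (l x : 'rV[R]_n).

Lemma codiag_unit Y Z V l : codiag Y Z V l -> V \in unitmx.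
Proof. by case=> /esym/esym; rewrite -mulmxA => /mulmx1_unit[]. Qed.

Lemma qf_codiag Y Z V l x : codiag Y Z V l ->
  qf Z (x *m V) = \sum_i x 0 i ^+ 2 /\
  qf Y (x *m V) = \sum_i l 0 i * x 0 i ^+ 2.
Proof.
case=> VZ VY; rewrite -!qf_congr VZ VY /qf mulmx1; split.
  by rewrite mxE; apply: eq_bigr => i _; rewrite mxE expr2.
rewrite mul_mx_diag mxE; apply: eq_bigr => i _.
by rewrite !mxE expr2 mulrCA mulrA.
Qed.

(** The entry is the value of the form of [Y] at row [i] of [V], a nonzero vector because [V] is
    invertible. *)
Lemma codiag_gt0 Y Z V l i : pdmx Y -> codiag Y Z V l -> 0 < l 0 i.
Proof.
move=> pY cV; pose x : 'rV[R]_n := delta_mx 0 i.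
have : 0 < qf Y (x *m V).
  apply: qf_gt0 => //; apply/eqP => /(congr1 (mulmx^~ (invmx V))).
  rewrite mulmxK ?(codiag_unit cV) // mul0mx => /rowP/(_ i)/eqP.
  by rewrite !mxE !eqxx oner_eq0.
rewrite (qf_codiag x cV).2 (bigD1 i) //= big1 => [|j ji].
  by rewrite mxE !eqxx /= expr1n mulr1 addr0.
by rewrite mxE (negbTE ji) expr0n mulr0.
Qed.

Lemma mulmx1_invmx (m : nat) (A B : 'M[R]_m) : A *m B = 1%:M -> invmx A = B.
Proof.
by move=> AB; have [uA _] := mulmx1_unit AB; rewrite -[LHS]mulmx1 -AB mulKmx.
Qed.

Lemma codiag_inv Y Z V l : pdmx Y -> pdmx Z -> codiag Y Z V l ->
  codiag (invmx Y) (invmx Z) (invmx V)^T (\row_i (l 0 i)^-1).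
Proof.
move=> pY pZ cV; have uV := codiag_unit cV.
have inv C D : C \in unitmx -> V *m C *m V^T *m D = 1%:M ->
    (invmx V)^T *m invmx C *m ((invmx V)^T)^T = D.
  move=> uC /mulmx1_invmx <-; rewrite trmxK; apply: esym; apply: mulmx1_invmx.
  rewrite -!mulmxA [V^T *m (_ *m _)]mulmxA -trmx_mul mulVmx // trmx1 mul1mx.
  by rewrite [C *m _]mulmxA mulmxV // mul1mx mulmxV.
have l0 i := codiag_gt0 i pY cV.
case: cV => VZ VY; split; apply: inv; rewrite ?pdmx_unit //.
  by rewrite VZ mul1mx.
rewrite VY mulmx_diag -diag_const_mx; congr diag_mx.
by apply/rowP => i; rewrite !mxE mulfV // lt0r_neq0.
Qed.

Lemma codiag_congr Y Z V l T : T \in unitmx -> codiag Y Z V l ->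
  codiag (T^T *m Y *m T) (T^T *m Z *m T) (V *m (invmx T)^T) l.
Proof.
move=> uT [VZ VY].
have E C : V *m (invmx T)^T *m (T^T *m C *m T) *m (V *m (invmx T)^T)^T =
    V *m C *m V^T.
  rewrite trmx_mul trmxK !mulmxA -(mulmxA V) -trmx_mul mulmxV // trmx1 mulmx1.
  by rewrite mulmxK.
by split; rewrite E.
Qed.

(** [V] conjugates [Y Z^-1] to [diag_mx l], so the characteristic polynomial splits; unique
    factorization identifies the list chosen by [eigenvalues] with [l] up to order. *)
Lemma riem_dist_codiag Y Z V l : pdmx Z -> codiag Y Z V l ->
  riem_dist Y Z = Num.sqrt (\sum_i ln (l 0 i) ^+ 2).
Proof.
move=> pZ cV; have uV := codiag_unit cV; case: cV => VZ VY.
have YZ : V *m (Y *m invmx Z) = diag_mx l *m V.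
  have -> : invmx Z = V^T *m V.
    apply: mulmx1_invmx; rewrite mulmxA -[RHS](mulVmx uV); congr (_ *m _).
    by rewrite -[RHS]mulmx1 -VZ -!mulmxA mulKmx.
  by rewrite !mulmxA VY.
have chi : char_poly (Y *m invmx Z) = \prod_i ('X - (l 0 i)%:P).
  transitivity (char_poly (diag_mx l)); last first.
    rewrite char_poly_trig; last by apply: diag_mx_is_trig.
    by apply: eq_bigr => i _; rewrite mxE eqxx.
  apply: (@mulfI _ (\det (map_mx polyC V))).
    by rewrite det_map_mx polyC_eq0 -unitfE -unitmxE.
  rewrite /char_poly /char_poly_mx [RHS]mulrC -!det_mulmx.
  congr (\det _); rewrite mulmxBr mulmxBl -map_mxM YZ map_mxM.
  by rewrite scalar_mxC.
pose s := [seq l 0 i | i <- enum 'I_n].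
rewrite /riem_dist /eigenvalues; case: xgetP => [t _ tE|/(_ s)].
  have st : perm_eq t s.
    by apply: prod_XsubC_eq; rewrite -tE chi big_map big_enum.
  by rewrite (perm_big _ st) big_map big_enum.
(* The list [s] is a witness, so the default [[::]] is never returned. *)
by case; rewrite /= chi big_map big_enum.
Qed.

(** Inversion inverts the generalized eigenvalues, and the sign change of their logarithms
    disappears in the squares. *)
Lemma riem_dist_inv X Y : pdmx X -> pdmx Y ->
  riem_dist (invmx X) (invmx Y) = riem_dist X Y.
Proof.
move=> pX pY; have [V [l cV]] := codiag_exists pX.1 pY.
rewrite (riem_dist_codiag pY cV).
rewrite (riem_dist_codiag (pdmx_inv pY) (codiag_inv pX pY cV)).
congr Num.sqrt; apply: eq_bigr => i _; rewrite mxE lnV ?sqrrN //.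
by rewrite posrE (codiag_gt0 i pX cV).
Qed.

Lemma riem_dist_congr X Y T : T \in unitmx -> pdmx X -> pdmx Y ->
  riem_dist (T^T *m X *m T) (T^T *m Y *m T) = riem_dist X Y.
Proof.
move=> uT pX pY; have [V [l cV]] := codiag_exists pX.1 pY.
rewrite (riem_dist_codiag pY cV).
by rewrite (riem_dist_codiag (pdmx_congr uT pY) (codiag_congr uT cV)).
Qed.

(* Courant-Fischer by dimension count: the first [i + 1] generalized
   eigenvectors of one pencil and the last [n - i] of the other one span
   subspaces with a common nonzero vector. *)
Lemma codiag_common Y1 Z1 V1 l1 Y2 Z2 V2 l2 (i : 'I_n) :
  codiag Y1 Z1 V1 l1 -> (forall i j : 'I_n, (i <= j)%N -> l1 0 j <= l1 0 i) ->
  codiag Y2 Z2 V2 l2 -> (forall i j : 'I_n, (i <= j)%N -> l2 0 j <= l2 0 i) ->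
  exists2 x, x != 0 &
    l1 0 i * qf Z1 x <= qf Y1 x /\ qf Y2 x <= l2 0 i * qf Z2 x.
Proof.
move=> c1 s1 c2 s2; have u1 := codiag_unit c1; have u2 := codiag_unit c2.
(* [A] keeps rows [0..i] of [V1] and [B] keeps rows [i..n-1] of [V2]. Both include index [i], so the
   ranks add up to [n + 1]. *)
pose A : 'M[R]_n := pid_mx i.+1 *m V1; pose B : 'M[R]_n := copid_mx i *m V2.
have rA : \rank A = i.+1 by rewrite mxrankMfree ?row_free_unit // rank_pid_mx.
have rB : \rank B = (n - i)%N.
  by rewrite mxrankMfree ?row_free_unit // rank_copid_mx // ltnW.
have /rowV0Pn[x xAB x0] : (A :&: B)%MS != 0.
  rewrite -mxrank_eq0 -lt0n -(ltn_add2l (\rank (A + B)%MS)) addn0.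
  rewrite mxrank_sum_cap rA rB addSn subnKC ?ltnS ?rank_leq_col //; exact: ltnW.
exists x => //; move: xAB; rewrite sub_capmx => /andP[/submxP[a xa] /submxP[b xb]].
split.
  rewrite xa mulmxA; have [-> ->] := qf_codiag (a *m pid_mx i.+1) c1.
  rewrite mulr_sumr ler_sum // => j _.
  case: (leqP j i) => ji; first by rewrite ler_wpM2r ?sqr_ge0 ?s1.
  (* Coordinates beyond [i] vanish on the row space of [A]; the remaining ones have
     [l1 0 j >= l1 0 i] by sorting. *)
  suff -> : (a *m pid_mx i.+1 : 'rV[R]_n) 0 j = 0 by rewrite expr0n !mulr0.
  rewrite mxE big1 // => k _; rewrite mxE.
  by case: eqP => [->|_]; rewrite ?ltnS 1?leqNgt ?ji ?mulr0.
rewrite xb mulmxA; have [-> ->] := qf_codiag (b *m copid_mx i) c2.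
rewrite mulr_sumr ler_sum // => j _.
case: (leqP i j) => ij; first by rewrite ler_wpM2r ?sqr_ge0 ?s2.
suff -> : (b *m copid_mx i : 'rV[R]_n) 0 j = 0 by rewrite expr0n !mulr0.
rewrite mxE big1 // => k _; rewrite !mxE -val_eqE /=.
by case: eqP => [->|_]; rewrite ?ij ?subrr ?mulr0.
Qed.

End Codiag.

(** * Contraction of translations *)

(** The log-sum inequality [(g + y) ln ((g + y) / (g + z)) <= y ln (y / z)], obtained from
    [ln x <= x - 1] at [f] and at [f z / y], where [f = (g + y) / (g + z)]. *)
Lemma ln_add_contract (R : realType) (tau g y z : R) :
  0 <= tau -> 0 < z -> z <= y -> tau * y <= g ->
  ln ((g + y) / (g + z)) <= (1 + tau)^-1 * ln (y / z).
Proof.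
move=> t0 z0 zy gy; have y0 : 0 < y by apply: lt_le_trans zy.
have g0 : 0 <= g by apply: le_trans gy; rewrite mulr_ge0 // ltW.
have gy0 : 0 < g + y by rewrite ltr_wpDl.
have gz0 : 0 < g + z by rewrite ltr_wpDl.
have lnle (x : R) : 0 < x -> ln x <= x - 1.
  move=> x0; have {1}-> : x = 1 + (x - 1) by lra.
  by apply: le_ln1Dx; lra.
set L := ln (y / z); have L0 : 0 <= L by rewrite ln_ge0 // ler_pdivlMr ?mul1r.
set F := ln _; have F0 : 0 <= F.
  by rewrite ln_ge0 // ler_pdivlMr ?mul1r // lerD2l.
have key : (g + y) * F <= y * L.
  pose f := (g + y) / (g + z); have f0 : 0 < f by rewrite divr_gt0.
  have h1 := lnle _ f0.
  have h2 : ln (f * (z / y)) <= f * (z / y) - 1.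
    by apply: lnle; rewrite mulr_gt0 // divr_gt0.
  have h3 : ln (f * (z / y)) = F - L.
    by rewrite lnM ?posrE ?divr_gt0 // -(invf_div y z) lnV ?posrE ?divr_gt0.
  have : g * F + y * (F - L) <= g * (f - 1) + y * (f * (z / y) - 1).
    by rewrite -h3 lerD // ler_wpM2l // ltW.
  have -> : g * (f - 1) + y * (f * (z / y) - 1) = 0.
    by rewrite /f; field; rewrite !lt0r_neq0.
  by lra.
(* The factor arises from [(1 + tau) y <= g + y]. *)
rewrite ler_pdivlMl ?ltr_wpDr // -(ler_pM2l y0); apply: le_trans key.
by rewrite mulrA ler_wpM2r // mulrDr mulr1; lra.
Qed.

(* [y / z] and [(g + y) / (g + z)] are the Rayleigh quotients of the pencils
   [(Y, Z)] and [(G + Y, G + Z)] at a common vector. *)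
Lemma ln_rayleigh_contract (R : realType) (tau g y z a b : R) :
  0 <= tau -> 0 < y -> 0 < z -> tau * y <= g -> tau * z <= g ->
  0 < a -> 0 < b -> y <= a * z -> b * (g + z) <= g + y ->
  ln b <= Num.max 0 ((1 + tau)^-1 * ln a).
Proof.
move=> t0 y0 z0 gy gz a0 b0 yz bgy.
have g0 : 0 <= g by apply: le_trans gy; rewrite mulr_ge0 // ltW.
have gz0 : 0 < g + z by rewrite ltr_wpDl.
have gy0 : 0 < g + y by rewrite ltr_wpDl.
have bf : ln b <= ln ((g + y) / (g + z)).
  by rewrite ler_ln ?posrE ?divr_gt0 // ler_pdivlMr.
(* If [y <= z], the shifted quotient is at most 1 and its logarithm is covered by the [0] of the
   maximum. *)
apply: le_trans bf _; rewrite le_max; case: (leP y z) => h.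
  by rewrite ln_le0 // ler_pdivrMr ?mul1r ?lerD2l.
apply/orP; right; apply: le_trans (ln_add_contract t0 z0 (ltW h) gy) _.
rewrite ler_wpM2l ?invr_ge0 ?addr_ge0 // ler_ln ?posrE ?divr_gt0 //.
by rewrite ler_pdivrMr.
Qed.

(** The sorted eigenvalues of the two pencils are compared index by index: [|ln (m 0 i)|] is at most
    [(1 + tau)^-1 |ln (l 0 i)|]. *)
Lemma riem_dist_addl (R : realType) (n : nat) (tau : R) (G Y Z : 'M[R]_n) :
  0 <= tau -> pdmx G -> pdmx Y -> pdmx Z ->
  (forall x, tau * qf Y x <= qf G x) -> (forall x, tau * qf Z x <= qf G x) ->
  riem_dist (G + Y) (G + Z) <= (1 + tau)^-1 * riem_dist Y Z.
Proof.
move=> t0 pG pY pZ GY GZ; have pGY := pdmxD pG pY; have pGZ := pdmxD pG pZ.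
have [V [l cV sl]] := codiag_sorted pY.1 pZ.
have [W [m cW sm]] := codiag_sorted pGY.1 pGZ.
rewrite (riem_dist_codiag pZ cV) (riem_dist_codiag pGZ cW).
have r0 : 0 <= (1 + tau)^-1 by rewrite invr_ge0 addr_ge0.
rewrite -{1}(ger0_norm r0) -sqrtr_sqr -sqrtrM ?sqr_ge0 // mulr_sumr.
apply: ler_wsqrtr; apply: ler_sum => i _; rewrite -exprMn.
have l0 := codiag_gt0 i pY cV; have m0 := codiag_gt0 i pGY cW.
have up : ln (m 0 i) <= Num.max 0 ((1 + tau)^-1 * ln (l 0 i)).
  have [x x0 []] := codiag_common i cW sm cV sl; rewrite !qfD => h1 h2.
  by apply: (ln_rayleigh_contract t0 (qf_gt0 pY x0) (qf_gt0 pZ x0) _ _ l0 m0 h2 h1).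
(* The same estimate for the inverse Rayleigh quotients, with [Y] and [Z] exchanged. *)
have lo : - ln (m 0 i) <= Num.max 0 ((1 + tau)^-1 * - ln (l 0 i)).
  have [x x0 []] := codiag_common i cV sl cW sm; rewrite !qfD => h1 h2.
  rewrite -!lnV ?posrE //.
  apply: (ln_rayleigh_contract t0 (qf_gt0 pZ x0) (qf_gt0 pY x0) (GZ x) (GY x)).
  - by rewrite invr_gt0.
  - by rewrite invr_gt0.
  - by rewrite ler_pdivlMl.
  - by rewrite ler_pdivrMl.
(* With [a] the scaled [ln (l 0 i)] and [b = ln (m 0 i)], the two bounds place [b] between [0] and
   [a], whence [(a - b) (a + b) >= 0]. *)
move: up lo; rewrite mulrN.
move: (_ * ln (l 0 i)) (ln (m 0 i)) => a b; rewrite !le_max -subr_ge0 subr_sqr.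
case/orP=> h1; case/orP=> h2.
- have -> : b = 0 by lra.
  by rewrite subr0 addr0 -expr2 sqr_ge0.
- by rewrite mulr_le0 //; lra.
- by rewrite mulr_ge0 //; lra.
- by have -> : b = a; [lra | rewrite subrr mul0r].
Qed.

(** * Extreme eigenvalues and inverses *)

Lemma pdmx1 (R : realType) (n : nat) : pdmx (1%:M : 'M[R]_n).
Proof.
apply/pdmxP; split=> [|x x0]; first exact: trmx1.
have [i xi] : exists i, x 0 i != 0.
  apply/existsP; apply: contraR x0; rewrite negb_exists => /forallP x0.
  by apply/eqP/rowP => i; rewrite mxE; apply/eqP/negPn/x0.
rewrite /qf mulmx1 mxE (bigD1 i) //= ltr_pwDl //.
  by rewrite mxE -expr2 exprn_even_gt0.
by apply: sumr_ge0 => j _; rewrite mxE -expr2 sqr_ge0.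
Qed.

Lemma qf_scale_add (R : realType) (n : nat) (A : 'M[R]_n) (x y : 'rV[R]_n)
  (c : R) : A^T = A ->
  qf A (y + c *: x) =
    qf A y + 2 * c * (y *m A *m x^T) 0 0 + c ^+ 2 * qf A x.
Proof.
move=> sA; have yx : (x *m A *m y^T) 0 0 = (y *m A *m x^T) 0 0.
  have -> : x *m A *m y^T = (y *m A *m x^T)^T.
    by rewrite !trmx_mul trmxK sA mulmxA.
  by rewrite mxE.
rewrite /qf linearD linearZ /= !mulmxDl !mulmxDr -!scalemxAl -!scalemxAr.
move: yx; move: (x *m A *m y^T) (y *m A *m x^T) (x *m A *m x^T) (y *m A *m y^T).
by move=> e1 e2 e3 e4; rewrite !mxE => ->; ring.
Qed.

Section InverseBounds.
Context (R : realType) (n : nat).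
Implicit Types (N : 'M[R]_n) (x : 'rV[R]_n).

Lemma qf_invmx N x : pdmx N -> qf (invmx N) x = qf N (x *m invmx N).
Proof.
move=> pN; rewrite -qf_congr trmx_inv pN.1 mulVmx ?mul1mx //.
exact: pdmx_unit.
Qed.

(** With [y = x N^-1], expand [|x - a y|^2 >= 0]: the cross term is [x y^T = qf N y], and
    [a^2 |y|^2 <= a qf N y]. *)
Lemma qf_invmx_le N (a : R) : pdmx N -> 0 < a ->
  (forall x, a * qf 1%:M x <= qf N x) ->
  forall x, qf (invmx N) x <= a^-1 * qf 1%:M x.
Proof.
move=> pN a0 aN x; rewrite ler_pdivlMl // qf_invmx //.
set y := x *m invmx N; have xy : x = y *m N by rewrite mulmxKV ?pdmx_unit.
have := qf_ge0 (x + (- a) *: y) (pdmx1 R n).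
rewrite qf_scale_add ?trmx1 // mulmx1 [in (x *m _) 0 0]xy -/(qf N y) => h.
have := aN y; rewrite -(ler_pM2l a0); move: h; rewrite sqrrN expr2; lra.
Qed.

(** Expand the form of [N] at [y - b^-1 x], with [y = x N^-1]; the cross term is [x x^T]. *)
Lemma qf_invmx_ge N (b : R) : pdmx N -> 0 < b ->
  (forall x, qf N x <= b * qf 1%:M x) ->
  forall x, b^-1 * qf 1%:M x <= qf (invmx N) x.
Proof.
move=> pN b0 bN x; rewrite qf_invmx //.
set y := x *m invmx N; have xy : x = y *m N by rewrite mulmxKV ?pdmx_unit.
have := qf_ge0 (y + (- b^-1) *: x) pN.
rewrite qf_scale_add ?pN.1 // -xy.
have -> : (x *m x^T) 0 0 = qf 1%:M x by rewrite /qf mulmx1.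
have h : b^-1 ^+ 2 * qf N x <= b^-1 * qf 1%:M x.
  rewrite expr2 -mulrA; apply: ler_wpM2l; first by rewrite invr_ge0 ltW.
  by rewrite ler_pdivrMl.
by move: h; rewrite sqrrN; lra.
Qed.

End InverseBounds.

Section ExtremeEigenvalues.
Context (R : realType) (n : nat) (N : 'M[R]_n.+1) (pN : pdmx N).

(** Diagonalizing against the identity makes [V] orthogonal, so its rows are eigenvectors of [N];
    [lo] and [hi] are the last and first entries of the decreasing [l]. *)
Let rayleigh : exists lo hi : R,
  [/\ 0 < lo /\ eigenvalue N lo, 0 < hi /\ eigenvalue N hi &
      forall x, lo * qf 1%:M x <= qf N x <= hi * qf 1%:M x].
Proof.
have [V [l cV sl]] := codiag_sorted pN.1 (pdmx1 R n.+1).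
have l0 i := codiag_gt0 i pN cV; have uV := codiag_unit cV.
have ev i : eigenvalue N (l 0 i).
  case: cV => VV VN; apply/eigenvalueP; exists (row i V).
    rewrite -row_mul; have -> : V *m N = diag_mx l *m V.
      rewrite -VN -mulmxA; have -> : V^T *m V = 1%:M; last by rewrite mulmx1.
      by apply: mulmx1C; rewrite -VV mulmx1.
    by apply/rowP => j; rewrite mul_diag_mx !mxE.
  apply/eqP => /(congr1 (mulmx^~ (invmx V))).
  rewrite -row_mul mulmxV // mul0mx => /rowP/(_ i)/eqP.
  by rewrite !mxE eqxx oner_eq0.
exists (l 0 ord_max), (l 0 ord0); split=> // x.
rewrite -[x](mulmxKV uV); have [-> ->] := qf_codiag (x *m invmx V) cV.
rewrite !mulr_sumr; apply/andP; split; apply: ler_sum => i _.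
  by rewrite ler_wpM2r ?sqr_ge0 // sl // -ltnS.
by rewrite ler_wpM2r ?sqr_ge0 // sl.
Qed.

Let eigenvalue_bounds (lo hi a : R) :
  (forall x, lo * qf 1%:M x <= qf N x <= hi * qf 1%:M x) ->
  eigenvalue N a -> lo <= a <= hi.
Proof.
move=> h /eigenvalueP[v vN v0]; have v1 := qf_gt0 (pdmx1 R n.+1) v0.
have := h v; have -> : qf N v = a * qf 1%:M v.
  by rewrite /qf vN mulmx1 -scalemxAl mxE.
by rewrite !ler_pM2r.
Qed.

Lemma lambda_min_gt0 : 0 < lambda_min N.
Proof.
have [lo [hi [[lo0 elo] _ h]]] := rayleigh.
apply: lt_le_trans lo0 _; apply: lb_le_inf; first by exists lo.
by move=> a /= /(eigenvalue_bounds h)/andP[].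
Qed.

(** [lo] is itself an eigenvalue, so the infimum is at most [lo]; positivity above used the opposite
    inequality. *)
Lemma lambda_min_le x : lambda_min N * qf 1%:M x <= qf N x.
Proof.
have [lo [hi [[lo0 elo] _ h]]] := rayleigh.
apply: le_trans (proj1 (andP (h x))); apply: ler_wpM2r.
  exact: qf_ge0 (pdmx1 R _).
by apply: ge_inf => //; exists lo => a /= /(eigenvalue_bounds h)/andP[].
Qed.

Lemma le_lambda_max x : qf N x <= lambda_max N * qf 1%:M x.
Proof.
have [lo [hi [_ [hi0 ehi] h]]] := rayleigh.
apply: le_trans (proj2 (andP (h x))) _; apply: ler_wpM2r.
  exact: qf_ge0 (pdmx1 R _).
by apply: ub_le_sup => //; exists hi => a /= /(eigenvalue_bounds h)/andP[].
Qed.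

Lemma lambda_max_gt0 : 0 < lambda_max N.
Proof.
have [lo [hi [_ [hi0 ehi] h]]] := rayleigh.
apply: lt_le_trans hi0 _; apply: ub_le_sup => //.
by exists hi => a /= /(eigenvalue_bounds h)/andP[].
Qed.

End ExtremeEigenvalues.

(** * Matrix inversion identities *)

Section MatrixInversion.
Context (R : realType) (n : nat).
Implicit Types A Q M V W X : 'M[R]_n.

(** With [S = (U + D)^-1], the relation [(U + D) S U = U] rewrites the right-hand side as [D S U];
    each form cancels against one summand of [U^-1 + D^-1]. *)
Lemma invmx_parallel (U D : 'M[R]_n) :
  U \in unitmx -> D \in unitmx -> U + D \in unitmx ->
  invmx (invmx U + invmx D) = U - U *m invmx (U + D) *m U.
Proof.
move=> uU uD uUD; apply: mulmx1_invmx; set S := invmx (U + D).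
have E : U - U *m S *m U = D *m S *m U.
  have : (U + D) *m S *m U = U by rewrite mulmxV ?mul1mx.
  by rewrite !mulmxDl => {1}<-; rewrite addrAC subrr add0r.
rewrite mulmxDl {2}E mulmxBr -!mulmxA !mulKmx // mulVmx // subrK //.
Qed.

(** [C] is merely invertible because [tildeR], with its [- gamma^2] block, may be indefinite;
    positivity cannot be invoked for it. *)
Lemma invmx_woodbury (p : nat) (B : 'M[R]_(n, p)) (C : 'M[R]_p) X :
  X \in unitmx -> C \in unitmx ->
  invmx X + B *m invmx C *m B^T \in unitmx ->
  X - X *m B *m invmx (C + B^T *m X *m B) *m B^T *m X =
  invmx (invmx X + B *m invmx C *m B^T).
Proof.
set W := B *m invmx C *m B^T => uX uC uH; set H := invmx (invmx X + W).
have XWH : X - X *m W *m H = H.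
  have : (invmx X + W) *m H = 1%:M by rewrite mulmxV.
  move/(congr1 (mulmx X)); rewrite mulmx1 mulmxDl mulmxDr mulKVmx // => {1}<-.
  by rewrite mulmxA addrK.
have HWX : X - H *m W *m X = H.
  have : H *m (invmx X + W) = 1%:M by rewrite mulVmx.
  move/(congr1 (mulmx^~ X)); rewrite mul1mx mulmxDr mulmxDl mulmxKV // => {1}<-.
  by rewrite addrK.
(* Exhibiting a right inverse also establishes that [C + B^T X B] is invertible. *)
have -> : invmx (C + B^T *m X *m B) =
    invmx C - invmx C *m B^T *m H *m B *m invmx C.
  apply: mulmx1_invmx; rewrite mulmxBr !mulmxDl !mulmxA mulmxV // mul1mx.
  have -> : B^T *m X *m B *m invmx C *m B^T *m H *m B *m invmx C =
      B^T *m (X *m W *m H) *m B *m invmx C by rewrite /W !mulmxA.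
  have -> : B^T *m X *m B *m invmx C = B^T *m H *m B *m invmx C +
      B^T *m (X *m W *m H) *m B *m invmx C.
    by rewrite -!mulmxDl -mulmxDr -{1}XWH subrK.
  by rewrite addrK.
have XWHWX : X *m W *m H *m W *m X = X *m W *m X - X *m W *m H.
  by rewrite -{2}HWX mulmxBr !mulmxA opprB addrC subrK.
have -> : X *m B *m (invmx C - invmx C *m B^T *m H *m B *m invmx C) *m B^T *m X =
    X *m W *m X - X *m W *m H *m W *m X.
  by rewrite /W mulmxBr !mulmxBl !mulmxA.
by rewrite XWHWX subKr XWH.
Qed.

(* With [K = M^-1 + Q^-1], the left-hand side is
   [Q^-1 - Q^-1 (V + K)^-1 Q^-1] and [(Q + M)^-1] is [Q^-1 - Q^-1 K^-1 Q^-1];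
   the difference is found from [K^-1 - (V + K)^-1 = (K + K V^-1 K)^-1]. *)
Lemma invmx_riccati Q M V : pdmx Q -> pdmx M -> pdmx V ->
  let T := (invmx M + invmx Q) *m Q in
  invmx (Q + invmx (V + invmx M)) =
  invmx (Q + M) + invmx (Q + Q *m invmx M *m Q + T^T *m invmx V *m T).
Proof.
move=> pQ pM pV T; pose q := invmx Q; pose m := invmx M.
have [pq pm] := (pdmx_inv pQ, pdmx_inv pM).
have [[uQ uq] um] := (pdmx_unit pQ, pdmx_unit pq, pdmx_unit pm).
have QmQ : Q + Q *m m *m Q = Q *m (m + q) *m Q.
  by rewrite mulmxDr mulmxDl mulmxV // mul1mx addrC.
have {T} -> : T = (m + q) *m Q by [].
rewrite -/m QmQ; have pK : pdmx (m + q) by apply: pdmxD.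
move KE: (m + q) pK => K pK.
have [uK uk] := (pdmx_unit pK, pdmx_unit (pdmx_inv pK)).
have uV := pdmx_unit (pdmx_inv pV).
have [pVK pVm] : pdmx (V + K) /\ pdmx (V + m) by split; apply: pdmxD.
have qVm : q + (V + m) = V + K by rewrite addrC -addrA KE.
have -> : invmx (Q + invmx (V + m)) = q - q *m invmx (V + K) *m q.
  rewrite -{1}(invmxK Q) -/q invmx_parallel ?qVm // ?pdmx_unit //.
have -> : invmx (Q + M) = q - q *m invmx K *m q.
  rewrite -{1}(invmxK Q) -{1}(invmxK M) invmx_parallel -/q -/m ?[q + m]addrC ?KE //.
have -> : Q *m K *m Q + (K *m Q)^T *m invmx V *m (K *m Q) =
    Q *m (K + K *m invmx V *m K) *m Q.
  by rewrite mulmxDr mulmxDl trmx_mul pQ.1 pK.1 !mulmxA.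
(* The parallel-sum formula at [K^-1] and [V^-1] leaves [K^-1 (K^-1 + V^-1)^-1 K^-1]. *)
have VK : invmx K - invmx (V + K) =
    invmx (K + K *m invmx V *m K).
  have -> : K + K *m invmx V *m K = K *m (invmx K + invmx V) *m K.
    by rewrite mulmxDr mulmxDl mulmxV // mul1mx.
  have pkv : pdmx (invmx K + invmx V) by apply: pdmxD; apply: pdmx_inv.
  have ukv := pdmx_unit pkv.
  rewrite [V + K]addrC -{2}(invmxK K) -{1}(invmxK V) invmx_parallel // subKr.
  apply: esym; apply: mulmx1_invmx.
  by rewrite !mulmxA mulmxK // mulmxK // mulmxV.
have pN : pdmx (K + K *m invmx V *m K).
  apply: pdmxD => //; rewrite -{1}pK.1; apply: pdmx_congr => //.
  exact: pdmx_inv.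
have -> : invmx (Q *m (K + K *m invmx V *m K) *m Q) =
    q *m (invmx K - invmx (V + K)) *m q.
  apply: mulmx1_invmx; rewrite VK -/q !mulmxA mulmxK //.
  by rewrite mulmxK ?pdmx_unit // mulmxV.
by rewrite mulmxBr mulmxBl addrA subrK.
Qed.

End MatrixInversion.

(** * Contraction of the Riccati operator *)

Lemma riccati_contract (R : realType) (n : nat) (Q A W : 'M[R]_n.+1) :
  pdmx Q -> pdmx W -> A \in unitmx ->
  let ric X := Q + A^T *m invmx (invmx X + W) *m A in
  let zeta := 1 / lambda_min
    (Q + Q *m invmx A *m W *m invmx (A^T) *m Q) in
  let epsilon := 1 / lambda_max (Q + A^T *m invmx W *m A) in
  let rho := zeta / (zeta + epsilon) in
  rho < 1 /\ forall X P, pdmx X -> pdmx P ->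
    riem_dist (ric X) (ric P) <= rho * riem_dist X P.
Proof.
move=> pQ pW uA ric zeta epsilon rho.
pose M := A^T *m invmx W *m A; have pM : pdmx M.
  by apply: pdmx_congr => //; apply: pdmx_inv.
have uAT : A^T \in unitmx by rewrite unitmx_tr.
have invM : invmx M = invmx A *m W *m invmx A^T.
  apply: mulmx1_invmx; rewrite /M !mulmxA mulmxK //.
  by rewrite mulmxKV ?pdmx_unit // mulmxV.
pose N := Q + Q *m invmx M *m Q; have pN : pdmx N.
  by apply: pdmxD => //; rewrite -{1}pQ.1; apply: pdmx_congr;
    [apply: pdmx_unit | apply: pdmx_inv].
have zetaE : zeta = (lambda_min N)^-1 by rewrite /zeta div1r /N invM !mulmxA.
have epsE : epsilon = (lambda_max (Q + M))^-1 by rewrite /epsilon div1r.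
have zeta0 : 0 < zeta by rewrite zetaE invr_gt0 lambda_min_gt0.
have pQM : pdmx (Q + M) by apply: pdmxD.
have eps0 : 0 < epsilon by rewrite epsE invr_gt0 lambda_max_gt0.
(* This is the translation factor for [tau = epsilon / zeta]. *)
have rhoE : rho = (1 + epsilon / zeta)^-1.
  by rewrite /rho; field; rewrite !lt0r_neq0 ?addr_gt0.
split; first by rewrite /rho ltr_pdivrMr ?addr_gt0 // mul1r ltrDl.
pose T := (invmx M + invmx Q) *m Q; pose C := A *m T.
have uT : T \in unitmx.
  rewrite unitmx_mul pdmx_unit ?pdmx_unit //.
  by apply: pdmxD; apply: pdmx_inv.
have uC : C \in unitmx by rewrite unitmx_mul uA.
pose Y X := N + C^T *m X *m C.
have pCX X : pdmx X -> pdmx (C^T *m X *m C) by apply: pdmx_congr.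
have pY X : pdmx X -> pdmx (Y X) by move=> pX; apply: pdmxD => //; apply: pCX.
have ricE X : pdmx X -> invmx (ric X) = invmx (Q + M) + invmx (Y X).
  (* [V] absorbs the outer factors: [A^T (X^-1 + W)^-1 A = (V + M^-1)^-1], because
     [M^-1 = A^-1 W A^-T]. *)
  move=> pX; pose V := invmx A *m invmx X *m invmx A^T.
  have pV : pdmx V.
    rewrite /V -trmx_inv -{1}[invmx A]trmxK.
    by apply: pdmx_congr; rewrite ?unitmx_tr ?unitmx_inv //; apply: pdmx_inv.
  have -> : ric X = Q + invmx (V + invmx M).
    congr (_ + _); rewrite /V invM -mulmxDl -mulmxDr; apply: esym.
    have uS : invmx X + W \in unitmx.
      by apply/pdmx_unit/pdmxD => //; apply: pdmx_inv.
    apply: mulmx1_invmx; rewrite !mulmxA mulmxKV // mulmxK //.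
    by rewrite mulVmx.
  rewrite invmx_riccati //.
  have -> : invmx V = A^T *m X *m A.
    apply: mulmx1_invmx; rewrite /V !mulmxA mulmxKV // mulmxKV ?pdmx_unit //.
    by rewrite mulVmx.
  by rewrite /Y /N /C [(A *m T)^T]trmx_mul !mulmxA.
have pric X : pdmx X -> pdmx (ric X).
  move=> pX; apply: pdmxD => //; apply: pdmx_congr => //.
  by apply/pdmx_inv/pdmxD => //; apply: pdmx_inv.
move=> X P pX pP.
have YN Z x : pdmx Z -> lambda_min N * qf 1%:M x <= qf (Y Z) x.
  move=> pZ; apply: le_trans (lambda_min_le pN x) _.
  by rewrite [leRHS]qfD lerDl; apply: qf_ge0; apply: pCX.
(* The two sides are separated by multiples of [|x|^2]: [(Y Z)^-1] is at most [zeta], [(Q + M)^-1]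
   at least [epsilon]. *)
have GY Z x : pdmx Z ->
    epsilon / zeta * qf (invmx (Y Z)) x <= qf (invmx (Q + M)) x.
  move=> pZ; have h1 := qf_invmx_le (pY Z pZ) (lambda_min_gt0 pN)
    (fun y => YN Z y pZ) x.
  have h2 := qf_invmx_ge pQM (lambda_max_gt0 pQM) (le_lambda_max pQM) x.
  apply: le_trans h2; rewrite -epsE -mulrA ler_pM2l // ler_pdivrMl //.
  by rewrite zetaE.
rewrite -riem_dist_inv; [|exact: pric..]; rewrite !ricE // rhoE.
apply: le_trans (riem_dist_addl _ (pdmx_inv pQM) (pdmx_inv (pY _ pX))
  (pdmx_inv (pY _ pP)) (fun x => GY X x pX) (fun x => GY P x pP)) _.
  by rewrite divr_ge0 ?ltW.
have tau0 : 0 < epsilon / zeta by rewrite divr_gt0.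
rewrite ler_pM2l; last by rewrite invr_gt0 addr_gt0.
rewrite riem_dist_inv; [|exact: pY..].
rewrite -[leRHS](riem_dist_congr uC pX pP).
(* With [tau = 0], translation by [N] is nonexpansive. *)
have := @riem_dist_addl R n.+1 0 N _ _ (lexx 0) pN (pCX _ pX) (pCX _ pP).
rewrite addr0 invr1 mul1r; apply => x; rewrite mul0r; exact: qf_ge0.
Qed.

(** * The lifted system *)

Lemma unitmx_mulmx_eq0 (R : realType) (n : nat) (A : 'M[R]_n) :
  (forall x : 'cV[R]_n, A *m x = 0 -> x = 0) -> A \in unitmx.
Proof.
move=> A0; rewrite -unitmx_tr -row_free_unit -kermx_eq0; apply/eqP/row_matrixP => i.
rewrite row0; apply: trmx_inj; rewrite trmx0; apply: A0; apply: trmx_inj.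
by rewrite trmx_mul trmxK -row_mul mulmx_ker row0 trmx0.
Qed.

Lemma unitmx_mulmx0 (R : realType) (n q : nat) (A : 'M[R]_n) (x : 'M[R]_(n, q)) :
  A \in unitmx -> A *m x = 0 -> x = 0.
Proof. by move=> uA Ax; rewrite -(mulKmx uA x) Ax mulmx0. Qed.

Lemma mulmx_castl (R : realType) (p q r s : nat) (e : q = r)
  (M : 'M[R]_(p, q)) (x : 'M[R]_(r, s)) :
  castmx (erefl p, e) M *m x = M *m castmx (esym e, erefl s) x.
Proof. by case: r / e x => x; rewrite !castmx_id. Qed.

Lemma castmx_mulmxl (R : realType) (p q r s : nat) (e : p = q)
  (M : 'M[R]_(p, r)) (x : 'M[R]_(r, s)) :
  castmx (e, erefl r) M *m x = castmx (e, erefl s) (M *m x).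
Proof. by case: q / e; rewrite !castmx_id. Qed.

(** This arithmetic position lets the partitions [n + nd] and [nd + n] of one vector be compared
    through [blk]. *)
Lemma Rank_rep (d p : nat) (j : 'I_d) (i : 'I_p) :
  tagnat.Rank (p_ := fun=> p) j i = (j * p + i)%N :> nat.
Proof.
rewrite tagnat.RankEsum (big_ord_narrow (ltnW (ltn_ord j))) /=.
by rewrite sum_nat_const card_ord.
Qed.

Lemma submxcol_blkdiag (R : realType) (d p q s : nat) (M : nat -> 'M[R]_(p, q))
  (x : 'M[R]_(rep d q, s)) (j : 'I_d) :
  submxcol (blkdiag d M *m x) j = M j *m submxcol x j.
Proof.
rewrite -[in LHS](submxcolK x) mul_mxblock_mxrow mxcolK (bigD1 j) //= eqxx.
by rewrite big1 ?addr0 // => k kj; rewrite eq_sym (negbTE kj) mul0mx.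
Qed.

Lemma tr_blkdiag (R : realType) (d p q : nat) (M : nat -> 'M[R]_(p, q)) :
  (blkdiag d M)^T = blkdiag d (fun i => (M i)^T).
Proof.
rewrite /blkdiag tr_mxblock; apply: eq_mxblock => i j.
by rewrite eq_sym; case: eqP => [->|]; rewrite ?trmx0.
Qed.

Section Blocks.
Context (R : realType) (n d : nat).
Implicit Types xi : 'cV[R]_(n + rep d n).

(* Entries past the end of [xi] read as 0, so this is meaningful for
   [j <= d]. *)
Definition blk xi (j : nat) : 'cV[R]_n :=
  \col_i odflt 0 (omap (fun r => xi r 0) (insub (j * n + i)%N)).

Lemma blkE xi (j : nat) (i : 'I_n) (r : 'I_(n + rep d n)) :
  r = (j * n + i)%N :> nat -> xi r 0 = blk xi j i 0.
Proof. by move=> e; rewrite mxE -e valK. Qed.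

(** The split [nd + n] of the columns of [liftLambda]. Block [j] of [lhead xi] is block [j] of [xi],
    whereas block [j] of [dsubmx xi] is block [j + 1]; this offset produces the time shift. *)
Definition lhead xi : 'cV[R]_(rep d n) :=
  usubmx (castmx (esym (addnC (rep d n) n), erefl 1%N) xi).

Definition llast xi : 'cV[R]_n :=
  dsubmx (castmx (esym (addnC (rep d n) n), erefl 1%N) xi).

Lemma blk_usubmx xi : usubmx xi = blk xi 0.
Proof. by apply/colP => i; rewrite [LHS]mxE; apply: blkE. Qed.

Lemma blk_dsubmx xi (j : 'I_d) : submxcol (dsubmx xi) j = blk xi j.+1.
Proof.
apply/colP => i; rewrite ?[LHS]mxE; apply: blkE.
by apply: etrans (congr1 (addn n) (Rank_rep j i)) _; rewrite mulSn addnA.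
Qed.

Lemma blk_lhead xi (j : 'I_d) : submxcol (lhead xi) j = blk xi j.
Proof.
apply/colP => i; rewrite ?[LHS]mxE castmxE cast_ord_id; apply: blkE.
exact: Rank_rep.
Qed.

Lemma blk_llast xi : llast xi = blk xi d.
Proof.
apply/colP => i; rewrite ?[LHS]mxE castmxE cast_ord_id; apply: blkE.
by rewrite /= sum_nat_const card_ord.
Qed.

Lemma blk_eq0 xi : (forall j, (j <= d)%N -> blk xi j = 0) -> xi = 0.
Proof.
move=> xi0; rewrite -[xi]vsubmxK blk_usubmx xi0 // (_ : dsubmx xi = 0) ?col_mx0 //.
by apply/mxcolP => j; rewrite blk_dsubmx xi0 // submxcol0.
Qed.

Lemma mul_colcast_row (p : nat) (a : 'M[R]_(p, rep d n)) (b : 'M[R]_(p, n)) xi :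
  colcast (row_mx a b) *m xi = a *m lhead xi + b *m llast xi.
Proof.
rewrite /colcast mulmx_castl -[castmx _ xi]vsubmxK mul_row_col.
by congr (_ *m _ + _ *m _).
Qed.

Lemma mul_colcast_shift (M : 'M[R]_(rep d n)) xi :
  colcast (block_mx 0 (0 : 'M[R]_n) M 0) *m xi = col_mx 0 (M *m lhead xi).
Proof.
rewrite /colcast mulmx_castl -[castmx _ xi]vsubmxK mul_block_col.
by rewrite !mul0mx !addr0.
Qed.

Lemma mul_tr_colcast_shift (M : 'M[R]_(rep d n)) xi :
  let y := (colcast (block_mx 0 (0 : 'M[R]_n) M 0))^T *m xi in
  lhead y = M^T *m dsubmx xi /\ llast y = 0.
Proof.
rewrite /colcast trmx_cast /= tr_block_mx castmx_mulmxl /lhead /llast.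
rewrite [castmx (esym _, _) _](castmxK (addnC (rep d n) n) (erefl 1%N)).
rewrite -[xi in usubmx (_ *m xi)]vsubmxK -[xi in dsubmx (_ *m xi)]vsubmxK.
by rewrite !mul_block_col !trmx0 !mul0mx !add0r col_mxKu col_mxKd.
Qed.

Lemma mul_tr_colcast_row (p : nat) (a : 'M[R]_(p, rep d n)) (z : 'cV[R]_p) :
  let y := (colcast (row_mx a (0 : 'M[R]_(p, n))))^T *m z in
  lhead y = a^T *m z /\ llast y = 0.
Proof.
rewrite /colcast trmx_cast /= tr_row_mx castmx_mulmxl /lhead /llast.
rewrite [castmx (esym _, _) _](castmxK (addnC (rep d n) n) (erefl 1%N)).
by rewrite mul_col_mx trmx0 mul0mx col_mxKu col_mxKd.
Qed.

Lemma lheadB xi eta : lhead (xi - eta) = lhead xi - lhead eta.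
Proof. by apply/colP => i; rewrite !(mxE, castmxE). Qed.

Lemma llastB xi eta : llast (xi - eta) = llast xi - llast eta.
Proof. by apply/colP => i; rewrite !(mxE, castmxE). Qed.

End Blocks.

Section LiftedSystem.
Context (R : realType) (n m : nat) (S : ltv_data R n m) (d t k : nat).
Let i0 := (t + d * k)%N.

Lemma liftLambda_usubmx (xi : 'cV[R]_(n + rep d n)) :
  usubmx (liftLambda S d t k *m xi) = blk xi 0.
Proof.
rewrite /liftLambda mulmxBl mul1mx mul_colcast_shift linearB /= col_mxKu subr0.
exact: blk_usubmx.
Qed.

Lemma liftLambda_dsubmx (xi : 'cV[R]_(n + rep d n)) (j : 'I_d) :
  submxcol (dsubmx (liftLambda S d t k *m xi)) j =
  blk xi j.+1 - dA S (i0 + j) *m blk xi j.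
Proof.
rewrite /liftLambda mulmxBl mul1mx mul_colcast_shift linearB /= col_mxKd.
by rewrite submxcolB submxcol_blkdiag blk_dsubmx blk_lhead.
Qed.

(** Forward substitution: a kernel vector starts at 0 and satisfies the homogeneous recursion. *)
Lemma liftLambda_unit : liftLambda S d t k \in unitmx.
Proof.
apply: unitmx_mulmx_eq0 => xi Lxi; apply: blk_eq0; elim=> [|j IH] jd.
  by rewrite -liftLambda_usubmx Lxi linear0.
have := liftLambda_dsubmx xi (Ordinal jd).
by rewrite Lxi linear0 submxcol0 IH ?(ltnW jd) // mulmx0 subr0.
Qed.

(** Transposition reverses time: these rows give the costate recursion, and [tr_liftLambda_llast]
    its terminal condition. *)
Lemma tr_liftLambda_lhead (p : 'cV[R]_(n + rep d n)) (j : 'I_d) :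
  submxcol (lhead ((liftLambda S d t k)^T *m p)) j =
  blk p j - (dA S (i0 + j))^T *m blk p j.+1.
Proof.
rewrite /liftLambda linearB /= trmx1 mulmxBl mul1mx lheadB.
have [-> _] := mul_tr_colcast_shift
  (blkdiag d (fun i => dA S (t + d * k + i)%N)) p.
by rewrite submxcolB tr_blkdiag submxcol_blkdiag blk_dsubmx blk_lhead.
Qed.

Lemma tr_liftLambda_llast (p : 'cV[R]_(n + rep d n)) :
  llast ((liftLambda S d t k)^T *m p) = blk p d.
Proof.
rewrite /liftLambda linearB /= trmx1 mulmxBl mul1mx llastB.
have [_ ->] := mul_tr_colcast_shift
  (blkdiag d (fun i => dA S (t + d * k + i)%N)) p.
by rewrite subr0 blk_llast.
Qed.

(* If [tildeA x0 = 0], the stationary trajectory [xi] of the game started at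
   [x0], with its costate [p], ends at [xi_d = 0] and [p_d = 0]; running the
   Hamiltonian recursion backwards gives [x0 = xi_0 = 0]. *)
Lemma tildeA_unit (gamma : R) :
  (forall i, dA S i \in unitmx) -> (forall i, dR S i \in unitmx) ->
  gamma != 0 -> tildeR S d t k gamma \in unitmx ->
  tildeA S d t k gamma \in unitmx.
Proof.
move=> uA uR gamma0 uRt; apply: unitmx_mulmx_eq0 => x0 Ax0.
pose L := liftLambda S d t k; have uL : L \in unitmx := liftLambda_unit.
pose G := liftGamma S d t k; pose Xi := liftXi S d t k.
pose C := liftC S d t k; pose D := liftD S d t k; pose E := liftE S d t k.
(* [v = (u, w)] is the stationary point, for initial state [x0], of
   [|z|^2 + u' R u - gamma^2 |w|^2], with [R] the lifted input weight. *)
pose v := - (invmx (tildeR S d t k gamma) *m (col_mx D^T E^T *m (C *m x0))).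
pose u := usubmx v; pose w := dsubmx v.
pose xi := invmx L *m (inj_first R n d *m x0 + Xi *m u + inj_rest R n d *m w).
pose z := G *m xi; pose p := (invmx L)^T *m (G^T *m z).
have vE : v = col_mx u w by rewrite vsubmxK.
have zE : z = C *m x0 + D *m u + E *m w.
  by rewrite /z /xi /C /liftC /D /liftD /E /liftE !mulmxDr !mulmxA.
have Rv : tildeR S d t k gamma *m v = - (col_mx D^T E^T *m (C *m x0)).
  by rewrite mulmxN mulKVmx.
(* The final state driven by [u] and [w] is exactly [tildeA x0]. *)
have xi_last : blk xi d = 0.
  have sel : sel_last R n d *m xi = llast xi.
    by rewrite /sel_last mul_colcast_row mul0mx add0r mul1mx.
  rewrite -blk_llast -sel; apply: etrans Ax0.
  have -> : tildeA S d t k gamma *m x0 =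
      liftA S d t k *m x0 + row_mx (liftB S d t k) (liftF S d t k) *m v.
    by rewrite /tildeA mulmxBl /v mulmxN !mulmxA.
  by rewrite vE mul_row_col /xi /liftA /liftB /liftF !mulmxDr !mulmxA addrA.
have pE : L^T *m p = G^T *m z.
  by rewrite /p mulmxA -trmx_mul mulVmx // trmx1 mul1mx.
have Dz : D^T *m z = Xi^T *m p by rewrite /p /D /liftD !trmx_mul !mulmxA.
have Ez : E^T *m z = dsubmx p.
  have -> : E^T *m z = (inj_rest R n d)^T *m p.
    by rewrite /p /E /liftE !trmx_mul !mulmxA.
  rewrite /inj_rest tr_col_mx trmx0 trmx1 -{1}[p]vsubmxK mul_row_col.
  by rewrite mul0mx mul1mx add0r.
(* The two block rows of [Rv] are stationarity in [u] and in [w]. *)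
have [Ru gw] : liftR S d t k *m u = - (D^T *m z) /\ gamma ^+ 2 *: w = E^T *m z.
  move: Rv; rewrite /tildeR vE mul_block_col mul_col_mx -/D -/E opp_col_mx.
  move/eq_col_mx => [e1 e2].
  rewrite zE !mulmxDr; split; apply/eqP; rewrite -subr_eq0.
    move/eqP: e1; rewrite -subr_eq0 !opprK mulmxDl !mulmxA -!addrA.
    by rewrite [X in is_true (_ + X == 0) -> _]addrA [X in is_true (_ + X == 0) -> _]addrC.
  move/eqP: e2; rewrite -subr_eq0 opprK -[X in _ -> is_true X]oppr_eq0 opprB.
  by rewrite mulmxBl mul_scalar_mx !mulmxA addrC !addrA.
have uj (j : 'I_d) : dR S (i0 + j) *m submxcol u j =
    - ((dB S (i0 + j))^T *m blk p j.+1).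
  have := congr1 (fun y => submxcol y j) Ru; rewrite submxcol_blkdiag => ->.
  rewrite Dz /Xi /liftXi tr_col_mx trmx0 -{1}[p]vsubmxK mul_row_col mul0mx add0r.
  by rewrite submxcolN tr_blkdiag submxcol_blkdiag blk_dsubmx.
have wj (j : 'I_d) : gamma ^+ 2 *: submxcol w j = blk p j.+1.
  by rewrite -blk_dsubmx -Ez -gw; apply/colP => i; rewrite !mxE.
have Lxi : L *m xi = inj_first R n d *m x0 + Xi *m u + inj_rest R n d *m w.
  by rewrite mulKVmx.
have xi0 : blk xi 0 = x0.
  rewrite -liftLambda_usubmx Lxi /inj_first /Xi /liftXi /inj_rest !mul_col_mx.
  by rewrite !add_col_mx col_mxKu mul1mx !mul0mx !addr0.
have xij (j : 'I_d) : blk xi j.+1 - dA S (i0 + j) *m blk xi j =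
    dB S (i0 + j) *m submxcol u j + submxcol w j.
  rewrite -liftLambda_dsubmx Lxi /inj_first /Xi /liftXi /inj_rest !mul_col_mx.
  rewrite !add_col_mx col_mxKd mul0mx add0r mul1mx submxcolD.
  by rewrite submxcol_blkdiag.
have [Gl Gr] := mul_tr_colcast_row
  (blkdiag d (fun i => sqrtmx (dQ S (t + d * k + i)%N))) z.
(* The last column block of [liftGamma] is zero: the output ignores the final state. *)
have p_last : blk p d = 0 by rewrite -tr_liftLambda_llast pE.
(* [N] is the transposed root of the state weight times the root; the backward step uses only
   linearity in [blk xi j]. *)
have pj (j : 'I_d) : exists N : 'M[R]_n,
    blk p j - (dA S (i0 + j))^T *m blk p j.+1 = N *m blk xi j.
  rewrite -tr_liftLambda_lhead pE Gl tr_blkdiag submxcol_blkdiag.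
  rewrite /z /G /liftGamma mul_colcast_row mul0mx addr0 submxcol_blkdiag.
  by rewrite blk_lhead mulmxA; eexists.
(* Counting from the end, a zero state and costate at time [i + 1] force [u], [w], the state and the
   costate at time [i] to vanish, in this order. *)
have back j : (j <= d)%N -> blk xi (d - j) = 0 /\ blk p (d - j) = 0.
  elim: j => [|j IH] jd; first by rewrite subn0.
  have [xi1 p1] := IH (ltnW jd).
  have id : (d - j.+1 < d)%N by rewrite ltn_subrL ltnS leq0n (leq_trans _ jd).
  pose i := Ordinal id; have iS : (i.+1 = d - j)%N by rewrite /= subnSK.
  have u0 : submxcol u i = 0.
    apply: unitmx_mulmx0 (uR (i0 + i)%N) _.
    by rewrite uj iS p1 mulmx0 oppr0.
  have w0 : submxcol w i = 0.
    apply/eqP; have /eqP := wj i; rewrite iS p1 scaler_eq0 sqrf_eq0.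
    by rewrite (negbTE gamma0).
  have x1 : blk xi i = 0.
    apply: unitmx_mulmx0 (uA (i0 + i)%N) _; apply: oppr_inj.
    have := xij i; rewrite iS xi1 u0 w0 mulmx0 addr0 sub0r => ->.
    by rewrite oppr0.
  have [N] := pj i; rewrite iS p1 x1 !mulmx0 subr0 => p2.
  by split.
by have [] := back d (leqnn d); rewrite subnn xi0.
Qed.

End LiftedSystem.

Theorem theorem3 (R : realType) (n m : nat) (hn : (0 < n)%N) (hm : (0 < m)%N)
  (S : ltv_data R n m) (hS : regular_bounded S)
  (d : nat) (hd : (0 < d)%N) (c : R) (hc : 0 < c)
  (hobs : unif_observable S d c) (hctr : unif_controllable S d c)
  (t k : nat) (gamma : R) (hgamma : 0 < gamma)
  (hR : tildeR S d t k gamma \in unitmx)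
  (hBRB : pdmx (tildeB S d t k *m invmx (tildeR S d t k gamma)
                  *m (tildeB S d t k)^T))
  (hQ : pdmx (tildeQ S d t k gamma)) :
  tilde_rho S d t k gamma < 1 /\
  forall X P : 'M[R]_n, pdmx X -> pdmx P ->
    riem_dist (lifted_riccati S d t k gamma X) (lifted_riccati S d t k gamma P)
      <= tilde_rho S d t k gamma * riem_dist X P.
Proof.
have [_ [pR [uA _]]] := hS.
have uAt : tildeA S d t k gamma \in unitmx.
  by apply: tildeA_unit => // [i|]; [apply: pdmx_unit | rewrite lt0r_neq0].
(* Size [n.+1] makes the spectra behind [lambda_min] and [lambda_max] nonempty. *)
case: n hn S hS hobs hctr hR hBRB hQ pR uA uAt => // n _ S _ _ _ hR hBRB hQ _ _ uAt.
have [rho1 contract] := riccati_contract hQ hBRB uAt.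
split; [exact: rho1 | move=> X P pX pP].
have ricE Z : pdmx Z -> lifted_riccati S d t k gamma Z =
    tildeQ S d t k gamma + (tildeA S d t k gamma)^T
      *m invmx (invmx Z + tildeBRB S d t k gamma) *m tildeA S d t k gamma.
  move=> pZ; rewrite /lifted_riccati invmx_woodbury ?(pdmx_unit pZ) //.
  by apply/pdmx_unit/pdmxD => //; apply: pdmx_inv.
by rewrite !ricE //; apply: contract.
Qed.
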